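(* Let $G$ be a $\sigma$-compact locally compact metrizable group, $\Gamma\subset G$ a discrete subgroup, and $X=G/\Gamma$. Let $\mu$ be a spread out and adapted Borel probability measure on $G$ and suppose that $X$ has finite volume. Then the random walk on $X$ given by $\mu$ is $\psi$-irreducible with $\psi\sim[m_X]$.
   Context: $X$ has finite volume if it admits a finite non-trivial $G$-invariant Radon measure $m_X$; $[m_X]$ denotes its measure class, and $\psi\sim[m_X]$ means that $\psi$ belongs to this class (has the same null sets as $m_X$). The random walk on $X$ given by $\mu$ is the Markov chain $(\Phi_n)_{n\ge0}$ with transition kernel $P(x,\cdot)=\mu*\delta_x$; $\mathbb{P}_x$ is the law of the chain started at $x$. For Borel $A\subset X$, $L(x,A)=\mathbb{P}_x[\Phi_n\in A\text{ for some }n\ge1]$. A $\sigma$-finite measure $\varphi$ on $X$ is an irreducibility measure if $\varphi(A)>0$ implies $L(x,A)>0$ for all $x\in X$. The chain is $\psi$-irreducible if it admits a non-trivial irreducibility measure; then there is a maximal irreducibility measure (one with respect to which every irreducibility measure is absolutely continuous), unique up to equivalence, and $\psi$ always denotes such a maximal one. $\mu$ is spread out if for some $n_0\in\mathbb{N}$ the convolution power $\mu^{*n_0}$ is not singular with respect to Haar measure on $G$; adapted if the closed subgroup generated by $\operatorname{supp}(\mu)$ is $G$. *)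

(* Defs.v *)
From HB Require Import structures.
From mathcomp Require Import all_boot all_order all_algebra.
From mathcomp Require Import generic_quotient.
From mathcomp Require Import all_classical all_reals all_analysis.

Set Implicit Arguments.
Unset Strict Implicit.
Unset Printing Implicit Defensive.

Import Order.TTheory GRing.Theory Num.Theory.

Local Open Scope classical_set_scope.
Local Open Scope ring_scope.

HB.mixin Record Group_isTopologicalGroup G of Group G & Topological G := {
  mulg_continuous : continuous (fun p : G * G => (p.1 * p.2)%g) ;
  invg_continuous : continuous (fun x : G => (x^-1)%g)
}.

(* The base point plays no role; it is there because measurable types, hence
   Borel spaces, are pointed. *)
#[short(type="topGroupType")]
HB.structure Definition TopologicalGroup :=
  {G of Group G & PointedTopological G & Group_isTopologicalGroup G}.

Section topology.

Definition metrizable (R : realType) (T : topologicalType) : Prop :=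
  exists d : T -> T -> R,
    [/\ forall x y, d x y = 0 <-> x = y,
        forall x y, d x y = d y x,
        forall x y z, d x z <= d x y + d y z
      & forall x, nbhs x =
          filter_from [set e : R | 0 < e] (fun e => [set y | d x y < e])].

Definition sigma_compact (T : topologicalType) : Prop :=
  exists2 K : nat -> set T, forall n, compact (K n) & \bigcup_n K n = setT.

End topology.

Section coset_space.
Variables (G : topGroupType) (Gamma : groupClosed G).
Local Open Scope quotient_scope.
Local Open Scope group_scope.

Definition discrete_subgroup : Prop := [set` Gamma] `<=` isolated [set` Gamma].

Definition lcoset_rel : rel G := fun x y => x^-1 * y \in Gamma.

Lemma lcoset_rel_refl : reflexive lcoset_rel.
Proof. by move=> x; rewrite /lcoset_rel mulVg gpred1. Qed.

Lemma lcoset_rel_sym : symmetric lcoset_rel.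
Proof. by move=> x y; rewrite /lcoset_rel -gpredV invgM invgK. Qed.

Lemma lcoset_rel_trans : transitive lcoset_rel.
Proof.
move=> y x z xy yz; rewrite /lcoset_rel -[z](mulVKg y) mulgA.
by rewrite gpredM.
Qed.

Canonical lcoset_equiv :=
  EquivRel lcoset_rel lcoset_rel_refl lcoset_rel_sym lcoset_rel_trans.

Definition coset_space : ptopologicalType :=
  quotient_topology {eq_quot lcoset_equiv}.

Definition coset_pi (h : G) : coset_space := \pi_({eq_quot lcoset_equiv}) h.

Definition coset_act (g : G) (x : coset_space) : coset_space :=
  coset_pi (g * repr (x : {eq_quot lcoset_equiv})).

Lemma coset_act_pi g h : coset_act g (coset_pi h) = coset_pi (g * h).
Proof.
rewrite /coset_act /coset_pi; apply/eqmodP => /=.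
rewrite /lcoset_rel invgM -mulgA mulKg -/(lcoset_rel _ _).
by apply/(@eqmodP _ lcoset_equiv); rewrite reprK.
Qed.

End coset_space.

Notation borel T := (g_sigma_algebraType (@open T)).

Section borel_measures.
Local Open Scope ereal_scope.
Variables (R : realType) (T : ptopologicalType).
Implicit Type m : set (borel T) -> \bar R.

Definition radon m : Prop :=
  (forall K : set T, compact K -> m K < +oo) /\
  (forall A : set (borel T), measurable A ->
     m A = ereal_sup [set m K | K in [set K : set T | compact K /\ K `<=` A]]).

Definition msupport m : set T :=
  [set x | forall U, open_nbhs x U -> 0 < m U].

Definition mutually_singular m1 m2 : Prop :=
  exists N : set (borel T), [/\ measurable N, m1 N = 0 & m2 (~` N) = 0].

End borel_measures.

Section convolution.
Local Open Scope ereal_scope.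
Variables (R : realType) (G : topGroupType).

(* Plain set functions are used, because the product of two Borel
   sigma-algebras can be smaller than that of the product space; the two agree
   when G and Y are second countable. *)
Definition convolution (Y : ptopologicalType) (act : G -> Y -> Y)
    (mu : set (borel G) -> \bar R) (nu : set (borel Y) -> \bar R) :
    set (borel Y) -> \bar R :=
  pushforward (product_measure1 mu nu)
    (fun p : borel G * borel Y => act p.1 p.2 : borel Y).

Fixpoint convolution_pow (mu : set (borel G) -> \bar R) (n : nat) :
    set (borel G) -> \bar R :=
  if n is k.+1 then convolution (fun g h : G => (g * h)%g) mu
                                (convolution_pow mu k)
  else dirac (1%g : borel G).

Definition haar_measure (m : set (borel G) -> \bar R) : Prop :=
  [/\ radon m, m setT != 0
    & forall (g : G) (A : set (borel G)), measurable A ->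
        m ((fun x : G => (g * x)%g) @^-1` A) = m A].

(* All Haar measures, left or right, have the same null sets. *)
Definition spread_out (mu : set (borel G) -> \bar R) : Prop :=
  exists2 m : {measure set (borel G) -> \bar R}, haar_measure m &
  exists2 n : nat, (0 < n)%N & ~ mutually_singular (convolution_pow mu n) m.

Definition closed_subgroup (H : set G) : Prop :=
  closed H /\ group_closed (fun x : G => x \in H).

Definition adapted (mu : set (borel G) -> \bar R) : Prop :=
  smallest closed_subgroup (msupport mu) = setT.

Definition walk_kernel (Gamma : groupClosed G) (mu : set (borel G) -> \bar R)
    (x : borel (coset_space Gamma)) : set (borel (coset_space Gamma)) -> \bar R
  := convolution (@coset_act G Gamma) mu (dirac x).

(* [invariant_volume mX] : mX witnesses that G / Gamma has finite volume. *)
Definition invariant_volume (Gamma : groupClosed G)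
    (mX : {finite_measure set (borel (coset_space Gamma)) -> \bar R}) : Prop :=
  [/\ radon mX, mX setT != 0
    & forall (g : G) (A : set (borel (coset_space Gamma))), measurable A ->
        mX (coset_act g @^-1` A) = mX A].

End convolution.

Arguments walk_kernel {R G} Gamma mu x _.

Section markov_chain.
Local Open Scope ereal_scope.
Variables (R : realType) (d : measure_display) (X : measurableType d).

Definition cylinders : set (set (nat -> X)) :=
  [set C | exists n (A : set X), measurable A /\ C = [set w | A (w n)]].

Definition paths := g_sigma_algebraType cylinders.

Variable P : X -> set X -> \bar R.

Definition is_chain_law (x : X) (Q : probability paths R) : Prop :=
  (forall A : set X, measurable A -> Q [set w | A (w 0%N)] = dirac x A) /\
  (forall (n : nat) (A : nat -> set X), (forall i, measurable (A i)) ->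
     Q [set w | forall i, (i <= n.+1)%N -> A i (w i)] =
     \int[Q]_(w in [set w | forall i, (i <= n)%N -> A i (w i)])
        P (w n) (A n.+1)).

(* For a probability kernel P there is exactly one law satisfying
   [is_chain_law x] (Ionescu-Tulcea), so that the default value is junk. *)
Definition chain_law (x : X) : probability paths R :=
  xget (dirac (cst x : paths) : probability paths R) (is_chain_law x).

Definition hitting_prob (x : X) (A : set X) : \bar R :=
  chain_law x [set w | exists2 n : nat, (1 <= n)%N & A (w n)].

Definition irreducibility_measure
    (phi : {sigma_finite_measure set X -> \bar R}) : Prop :=
  forall A : set X, measurable A -> 0 < phi A ->
    forall x : X, 0 < hitting_prob x A.

Definition psi_irreducible : Prop :=
  exists2 phi : {sigma_finite_measure set X -> \bar R},
    phi setT != 0 & irreducibility_measure phi.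

Definition maximal_irreducibility_measure
    (psi : {sigma_finite_measure set X -> \bar R}) : Prop :=
  irreducibility_measure psi /\
  forall phi : {sigma_finite_measure set X -> \bar R},
    irreducibility_measure phi -> phi `<< psi.

End markov_chain.

(* Main.v *)
Require Import Defs.
From HB Require Import structures.
From mathcomp Require Import all_boot all_order all_algebra.
From mathcomp Require Import finmap generic_quotient lra.
From mathcomp Require Import all_classical all_reals all_analysis.

(** Write T for the operator F |-> (y |-> int F (g y) dmu(g)), so that T^n 1_A
    x is the probability that the walk started at x lies in A at time n. A law
    of the chain is first constructed, from an independent mu-distributed
    sequence acting on the starting point ([iid_law_exists],
    [chain_law_exists]); every law of the chain has the marginals T^n 1_A x,
    and so the probability of hitting A from x vanishes exactly when x belongs
    to the set [avoids] of points where all T^n 1_A with n >= 1 vanish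
    ([hitting_prob_eq0]). It remains to prove that m_X is an irreducibility
    measure that dominates all the others: it is then maximal, and any maximal
    one is equivalent to it.

    Domination is stationarity. As m_X is invariant, T preserves integrals
    against m_X; if m_X A = 0, then almost every point avoids A, and since m_X
    is not zero some point does, so that no irreducibility measure charges A
    ([irreducible_dominated]).

    For irreducibility let m_X A > 0 and let B be the set of points that avoid
    A. B is absorbing: from a point of B the walk almost surely stays in B.
    Integrating this over B, the set of y in B with g y not in B is m_X-null
    for mu-almost every g ([avoids_almost_invariant]). Because m_X is finite,
    the g with this property form a subgroup, and because m_X is Radon this
    subgroup is closed ([almost_stabilizer_subgroup]). It carries mu, so it is
    all of G as mu is adapted. Here finiteness replaces any recurrence
    argument.

    Let m be a Haar measure. For a transitive action of G that preserves lam,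
    Tonelli applied to 1_C (g^-1 y) gives m {g | g^-1 x in C} * lam Y = lam C *
    m G for every x ([orbit_measure]). Hence C is lam-null exactly when one,
    equivalently each, of the sets {g | g^-1 x in C} is m-null. For Y = X this
    makes m_X ergodic, so that B is null or conull; conull is excluded by m_X A
    > 0. For Y = G, acted on by left multiplication, it says that inversion
    preserves m-null sets. Together, for each x, the set {g | g x in B} is
    m-null. If x were in B, this same set would have full measure for every
    convolution power of mu, and all these powers would be singular to m,
    against mu being spread out. So B is empty ([avoids_empty]).

    The topology serves to make this measure theory available: G is second
    countable, so that multiplication and the action are measurable for the
    product of the Borel sigma-algebras, and X is Hausdorff, so that compact
    sets are Borel. *)

Set Implicit Arguments.
Unset Strict Implicit.
Unset Printing Implicit Defensive.

Import Order.TTheory GRing.Theory Num.Theory.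
(* Makes the Borel sigma-algebra of the extended reals the inferred one. *)
Import measurable_realfun.

Local Open Scope classical_set_scope.
Local Open Scope ring_scope.

(** * Iterated random maps *)

Lemma measurable_EFin_indic d (T : measurableType d) (R : realType) (A : set T) :
  measurable A -> measurable_fun setT ((fun x => (\1_A x)%:E) : T -> \bar R).
Proof. by move=> mA; apply/measurable_EFinP; exact: measurable_indic. Qed.

Lemma measurable_preimage d d' (T : measurableType d) (T' : measurableType d')
    (f : T -> T') (A : set T') :
  measurable_fun setT f -> measurable A -> measurable (f @^-1` A).
Proof. by move=> mf mA; rewrite -[X in measurable X]setTI; exact: mf. Qed.

Section random_iteration.
Local Open Scope ereal_scope.
Context dE dY (E : measurableType dE) (Y : measurableType dY) (R : realType).
Variables (mu : probability E R) (f : E * Y -> Y).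

(** The operator of the Markov chain y |-> f (g, y) with g of law mu: the
    integral of F against the law of the next state. *)
Definition transfer (F : Y -> \bar R) (y : Y) : \bar R :=
  \int[mu]_g F (f (g, y)).

Lemma transfer_ge0 F : (forall y, 0 <= F y) -> forall y, 0 <= transfer F y.
Proof. by move=> F0 y; apply: integral_ge0. Qed.

Lemma iter_transfer_ge0 n F :
  (forall y, 0 <= F y) -> forall y, 0 <= iter n transfer F y.
Proof. by move=> F0; elim: n => //= n IH; exact: transfer_ge0. Qed.

Hypothesis mf : measurable_fun setT f.

Let f_mfun : {mfun (E * Y)%type >-> Y} :=
  HB.pack f (isMeasurableFun.Build _ _ _ _ _ mf).

Lemma measurable_transfer F : (forall y, 0 <= F y) ->
  measurable_fun setT F -> measurable_fun setT (transfer F).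
Proof.
move=> F0 mF.
apply: (@measurable_fun_fubini_tonelli_G _ _ E Y R mu (F \o f)) => //.
- exact: measurableT_comp.
- by move=> x; exact: F0.
Qed.

Lemma measurable_iter_transfer n F : (forall y, 0 <= F y) ->
  measurable_fun setT F -> measurable_fun setT (iter n transfer F).
Proof.
move=> F0 mF; elim: n => //= n IH; apply: measurable_transfer => //.
exact: iter_transfer_ge0.
Qed.

(** The adjoint of [transfer]: the law of the next state when the present one
    has law nu. *)
Definition step_law (nu : probability Y R) : probability Y R :=
  distribution (mu \x nu) f_mfun.

Lemma integral_step_law (nu : probability Y R) F :
    (forall y, 0 <= F y) -> measurable_fun setT F ->
  \int[step_law nu]_y F y = \int[nu]_y transfer F y.
Proof.
move=> F0 mF; rewrite /step_law ge0_integral_distribution//=.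
rewrite (@fubini_tonelli1 _ _ _ _ _ mu nu (F \o f))//; last 2 first.
- exact: measurableT_comp.
- by move=> x; exact: F0.
rewrite fubini_tonelli//; last by move=> x; exact: F0.
exact: measurableT_comp.
Qed.

Lemma integral_iter_step_law x n F :
    (forall y, 0 <= F y) -> measurable_fun setT F ->
  \int[iter n step_law (dirac x : probability Y R)]_y F y = iter n transfer F x.
Proof.
elim: n F => [|n IH] F F0 mF.
  by rewrite integral_dirac// diracE in_setT mul1e.
rewrite [iter n.+1 step_law _]/= integral_step_law// iterSr IH//.
- exact: transfer_ge0.
- exact: measurable_transfer.
Qed.

Lemma iter_step_lawE x n (A : set Y) : measurable A ->
  iter n step_law (dirac x : probability Y R) A =
  iter n transfer (fun y => (\1_A y)%:E) x.
Proof.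
move=> mA; rewrite -integral_iter_step_law//; last exact: measurable_EFin_indic.
by rewrite integral_indic// setIT.
Qed.

End random_iteration.

Section chain_marginals.
Local Open Scope ereal_scope.
Context dE dY (E : measurableType dE) (Y : measurableType dY) (R : realType).
Variables (mu : probability E R) (f : E * Y -> Y).
Hypothesis mf : measurable_fun setT f.
Variable P : Y -> set Y -> \bar R.
Hypothesis PE : forall y A, measurable A ->
  P y A = transfer mu f (fun z => (\1_A z)%:E) y.

Lemma measurable_coord n : measurable_fun setT (fun w : paths Y => w n).
Proof.
by move=> _ A mA; rewrite setTI; apply: sub_sigma_algebra; exists n, A.
Qed.

Let coord n : {mfun (paths Y) >-> Y} :=
  HB.pack (fun w : paths Y => w n)
    (isMeasurableFun.Build _ _ _ _ _ (measurable_coord n)).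

(** The second axiom of a chain law with no constraint before the last time
    says that the marginals obey [step_law], hence are dual to [transfer]. *)
Lemma chain_law_marginal x (Q : probability (paths Y) R) n A :
    is_chain_law P x Q -> measurable A ->
  Q [set w | A (w n)] = iter n (transfer mu f) (fun z => (\1_A z)%:E) x.
Proof.
move=> [Q0 QS]; elim: n A => [|n IH] A mA; first by rewrite Q0.
have mAi i : measurable (if i == n.+1 then A else setT) by case: ifP.
have := QS n _ mAi; rewrite eqxx.
rewrite (_ : [set w | forall i, (i <= n.+1)%N -> _] = [set w | A (w n.+1)]);
  last first.
  apply/seteqP; split => w /=; first by move=> /(_ n.+1 (leqnn _)); rewrite eqxx.
  by move=> Aw i _; case: eqP => [->|].
rewrite (_ : [set w | forall i, (i <= n)%N -> _] = setT); last first.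
  by apply/seteqP; split => w //= _ i lein; rewrite ltn_eqF.
move=> ->.
under eq_integral do rewrite PE//.
have F0 y : 0 <= transfer mu f (fun z => (\1_A z)%:E) y.
  by apply: transfer_ge0 => z; rewrite lee_fin.
have mF : measurable_fun setT (transfer mu f (fun z => (\1_A z)%:E)).
  by apply: measurable_transfer => //; exact: measurable_EFin_indic.
rewrite iterSr -(integral_iter_step_law mu mf)//.
apply: (etrans (esym (ge0_integral_distribution (P := Q) (coord n) mF F0))).
apply: eq_measure_integral => B mB _.
exact: etrans (IH B mB) (esym (iter_step_lawE mu mf x n mB)).
Qed.

Hypothesis chain_exists : forall x, exists Q, is_chain_law P x Q.

(** Hitting is a countable union over times, so it is null exactly when each
    time is. *)
Lemma hitting_prob_eq0 x A : measurable A ->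
  hitting_prob P x A = 0 <->
  forall n, iter n.+1 (transfer mu f) (fun z => (\1_A z)%:E) x = 0.
Proof.
move=> mA; have [Q0 Q0P] := chain_exists x.
have QP : is_chain_law P x (chain_law P x) by exact: xgetPex.
have mn n : measurable [set w : paths Y | A (w n)].
  exact: measurable_preimage (measurable_coord n) mA.
rewrite /hitting_prob.
have -> : [set w : nat -> Y | exists2 n, (1 <= n)%N & A (w n)] =
    \bigcup_n [set w | A (w n.+1)].
  apply/seteqP; split => [w [[//|n] _ Aw]|w [n _ Aw]]; first by exists n.
  by exists n.+1.
split=> [h n|h].
  rewrite -(chain_law_marginal n.+1 QP mA); apply/eqP.
  rewrite eq_le measure_ge0 andbT -h le_measure ?inE//.
    by apply: bigcup_measurable.
  by move=> w Aw; exists n.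
apply/eqP; rewrite eq_le measure_ge0 andbT.
apply: (le_trans (measure_sigma_subadditive _ _ _ (@subset_refl _ _))) => //.
  by apply: bigcup_measurable.
by rewrite eseries0// => n _ _; rewrite /= (chain_law_marginal n.+1 QP mA).
Qed.

End chain_marginals.

(** * Independent sequences *)

Section sequences_of_noise.
Context d (E : measurableType d).

Definition path_cons (p : E * paths E) : paths E :=
  fun n => if n is k.+1 then p.2 k else p.1.

Lemma measurable_to_paths d' (T : measurableType d') (h : T -> paths E) :
  (forall n, measurable_fun setT (fun t => h t n)) -> measurable_fun setT h.
Proof.
move=> mh; apply: (@measurability _ _ T (paths E) setT h (@cylinders _ E)) => //.
move=> _ [_ [n [A [mA ->]]] <-]; rewrite setTI.
exact: (measurable_preimage (mh n) mA).
Qed.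

Lemma measurable_path_cons : measurable_fun setT path_cons.
Proof.
apply: measurable_to_paths => -[|n]; first exact: measurable_fst.
exact: (measurableT_comp (measurable_coord n) measurable_snd).
Qed.

Definition depends_on_first n (C : set (paths E)) : Prop :=
  forall v w, (forall i, (i < n)%N -> v i = w i) -> C v -> C w.

Definition cylinder (C : set (paths E)) : Prop :=
  measurable C /\ exists n, depends_on_first n C.

Definition cons_section (C : set (paths E)) (g : E) : set (paths E) :=
  [set w | C (path_cons (g, w))].

Lemma depends_on_firstW m n C :
  (m <= n)%N -> depends_on_first m C -> depends_on_first n C.
Proof. by move=> mn hC v w vw; apply: hC => i im; apply/vw/(leq_trans im). Qed.

Lemma depends_on_first_cons_section n C g :
  depends_on_first n.+1 C -> depends_on_first n (cons_section C g).
Proof. by move=> hC v w vw; apply: hC => -[|i]//=; rewrite ltnS; exact: vw. Qed.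

Lemma cylinder0 : cylinder set0.
Proof. by split => //; exists 0%N. Qed.

Lemma cylinderC C : cylinder C -> cylinder (~` C).
Proof.
move=> [mC [n nC]]; split; first exact: measurableC.
exists n => v w vw Cv Cw; apply: Cv; apply: nC Cw => i /vw; exact: esym.
Qed.

Lemma cylinderU C D : cylinder C -> cylinder D -> cylinder (C `|` D).
Proof.
move=> [mC [n nC]] [mD [m mD']]; split; first exact: measurableU.
exists (maxn n m) => v w vw [Cv|Dv]; [left|right].
- by apply: nC Cv => i ni; rewrite vw// leq_max ni.
- by apply: mD' Dv => i ni; rewrite vw// leq_max ni orbT.
Qed.

Lemma measurable_cons_section C g : measurable C -> measurable (cons_section C g).
Proof.
move=> mC; apply: (@measurable_preimage _ _ _ _ (fun w => path_cons (g, w))) => //.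
apply: measurableT_comp; first exact: measurable_path_cons.
exact: measurable_fun_pair.
Qed.

Lemma cylinder_cons_section C g : cylinder C -> cylinder (cons_section C g).
Proof.
move=> [mC [n nC]]; split; first exact: measurable_cons_section.
by exists n; apply: depends_on_first_cons_section; exact: depends_on_firstW nC.
Qed.

Lemma measurable_pathsE : @measurable _ (paths E) = <<s cylinder >>.
Proof.
apply/seteqP; split.
  apply: sub_smallest2r; first exact: smallest_sigma_algebra.
  move=> _ [n [A [mA ->]]]; split.
    exact: measurable_preimage (measurable_coord n) mA.
  by exists n.+1 => v w vw; rewrite /= vw.
by apply: smallest_sub; [exact: sigma_algebra_measurable|move=> C []].
Qed.

(** A copy of the sequence space that carries the algebra of cylinders rather
    than the sigma-algebra it generates, as the extension theorem requires. *)
Definition cylinder_type := nat -> E.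
HB.instance Definition _ := Pointed.on cylinder_type.
Definition cylinder_display : measure_display.
Proof. exact: default_measure_display. Qed.
HB.instance Definition _ := @isAlgebraOfSets.Build cylinder_display
  cylinder_type cylinder cylinder0 cylinderU cylinderC.

End sequences_of_noise.

Section iid_sequence.
Local Open Scope ereal_scope.
Context d (E : measurableType d) (R : realType).
Variable mu : probability E R.
Notation Om := (paths E).
Notation cyl := (cylinder_type E).

(** The law of the sequence whose first n entries are independent of law mu and
    whose other entries are a fixed default. *)
Definition head_law n : probability Om R :=
  iter n (step_law mu (@measurable_path_cons _ E))
    (dirac ((fun=> point) : Om) : probability Om R).

Lemma head_lawS n C : head_law n.+1 C = \int[mu]_g head_law n (cons_section C g).
Proof.
rewrite [head_law n.+1]/= /step_law /distribution /pushforward /=.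
rewrite /product_measure1; apply: eq_integral => g _ /=; congr (head_law n _).
by apply/seteqP; split => w; rewrite xsectionE.
Qed.

(** Entries that the event does not look at can be drawn or not. *)
Lemma head_law_stable n m C : depends_on_first n C -> (n <= m)%N ->
  head_law m C = head_law n C.
Proof.
elim: n m C => [|n IH] [|m] C nC // nm; last first.
  rewrite !head_lawS; apply: eq_integral => g _.
  by apply: IH => //; exact: depends_on_first_cons_section.
have [Cp|Cp] := pselect (C (fun=> point)).
  have -> : C = setT by apply/seteqP; split => // w _; apply: nC Cp.
  by rewrite !probability_setT.
have -> : C = set0.
  by apply/seteqP; split => // w Cw; apply: Cp; apply: nC Cw.
by rewrite !measure0.
Qed.

(** Some number of entries that decide C; any choice gives the same content by
    [head_law_stable]. *)
Definition rank (C : set Om) : nat := xget 0%N [set n | depends_on_first n C].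

Lemma rankP C : cylinder C -> depends_on_first (rank C) C.
Proof.
by move=> [_ nC]; exact: (@xgetPex _ 0%N [set n | depends_on_first n C]).
Qed.

Definition cylinder_content (C : set cyl) : \bar R := head_law (rank C) C.

Lemma cylinder_contentE n C : cylinder C -> (rank C <= n)%N ->
  cylinder_content C = head_law n C.
Proof.
by move=> cC nC; apply/esym/head_law_stable => //; exact: rankP.
Qed.

Lemma cylinder_content_head_law n C : cylinder C -> depends_on_first n C ->
  cylinder_content C = head_law n C.
Proof.
move=> cC nC; rewrite (@cylinder_contentE (maxn n (rank C)))// ?leq_maxr//.
by apply: head_law_stable => //; rewrite leq_maxl.
Qed.

Lemma cylinder_content_ge0 C : 0 <= cylinder_content C.
Proof. exact: measure_ge0. Qed.

Lemma cylinder_content_additive : measure_function.semi_additive cylinder_content.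
Proof.
move=> F n mF tF mUF.
(* A time late enough to decide all the cylinders at once. *)
pose N := maxn (rank (\big[setU/set0]_(k < n) F k)) (\max_(k < n) rank (F k)).
rewrite (@cylinder_contentE N)// ?leq_maxl// measure_semi_additive//.
- apply: eq_bigr => k _; rewrite (@cylinder_contentE N)//; first exact: mF.
  by rewrite leq_max (leq_bigmax k) orbT.
- by move=> k; have [] := mF k.
- by case: mUF.
Qed.

HB.instance Definition _ := isContent.Build _ _ _ cylinder_content
  cylinder_content_ge0 cylinder_content_additive.

Lemma cylinder_contentT : cylinder_content setT = 1.
Proof. exact: probability_setT. Qed.

Lemma cylinder_content_le1 C : cylinder C -> cylinder_content C <= 1.
Proof. by move=> [mC _]; exact: probability_le1. Qed.

Lemma cylinder_content_sectionE C g : cylinder C ->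
  cylinder_content (cons_section C g) = head_law (rank C) (cons_section C g).
Proof.
move=> cC; apply: cylinder_content_head_law; first exact: cylinder_cons_section.
apply: depends_on_first_cons_section; apply: depends_on_firstW (rankP cC).
exact: leqnSn.
Qed.

Lemma measurable_cylinder_content_section C : cylinder C ->
  measurable_fun setT (fun g => cylinder_content (cons_section C g)).
Proof.
move=> cC; under eq_fun do rewrite cylinder_content_sectionE//.
have := measurable_fun_xsection (head_law (rank C))
  (measurable_preimage (@measurable_path_cons _ E) cC.1).
apply: eq_measurable_fun => g _ /=; congr (head_law _ _).
by apply/seteqP; split => w; rewrite xsectionE.
Qed.

Lemma cylinder_content_section C : cylinder C ->
  cylinder_content C = \int[mu]_g cylinder_content (cons_section C g).
Proof.
move=> cC; rewrite (@cylinder_contentE (rank C).+1)// head_lawS.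
by apply: eq_integral => g _; rewrite cylinder_content_sectionE.
Qed.

(** A counterexample to countable subadditivity, except for the inclusion of
    the cylinder in the union. *)
Definition undercovered (p : set cyl * (nat -> set cyl)) : Prop :=
  [/\ cylinder p.1, forall k, cylinder (p.2 k) &
    \sum_(0 <= k <oo) cylinder_content (p.2 k) < cylinder_content p.1].

Definition cons_sections (p : set cyl * (nat -> set cyl)) (g : E) :=
  (cons_section p.1 g : set cyl, fun k => cons_section (p.2 k) g : set cyl).

(** The content of a cylinder is the mu-average of the contents of its
    sections, so a strict inequality between contents survives in some section.
    *)
Lemma undercovered_cons_sections p :
  undercovered p -> exists g, undercovered (cons_sections p g).
Proof.
move=> [cA cF]; apply: contraPP => /forallNP noG; apply/negP; rewrite -leNgt.
rewrite cylinder_content_section//.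
rewrite (eq_eseriesr (g := fun k =>
  \int[mu]_g cylinder_content (cons_section (p.2 k) g))); last first.
  by move=> k _; rewrite cylinder_content_section.
rewrite -integral_nneseries//; last first.
  by move=> k; exact: measurable_cylinder_content_section.
apply: ge0_le_integral => //.
- exact: measurable_cylinder_content_section.
- apply: ge0_emeasurable_sum => [k g _ _|k _]; first exact: cylinder_content_ge0.
  exact: measurable_cylinder_content_section.
- move=> g _; rewrite leNgt; apply/negP => lt; apply: (noG g).
  by split => //= [|k]; exact: cylinder_cons_section.
Qed.

(** Fixing the entries one at a time so that the sections stay undercovered
    produces a sequence w. It lies in A, as no section of A along w is empty,
    hence in some F k; but then the section of F k along w is eventually the
    whole space and has content 1, which leaves no room for a strict
    inequality. *)
Lemma cylinder_content_sigma_subadditive :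
  measurable_subset_sigma_subadditive cylinder_content.
Proof.
move=> A F cF cA AF; rewrite leNgt; apply/negP => lt.
have /choice[pick pickP] : forall p, exists g,
    undercovered p -> undercovered (cons_sections p g).
  move=> p; have [/undercovered_cons_sections[g]|np] := pselect (undercovered p).
    by exists g.
  by exists point.
pose st := fix st n :=
  if n is k.+1 then cons_sections (st k) (pick (st k)) else (A, F).
have stP n : undercovered (st n) by elim: n => [//|n] /=; exact: pickP.
pose w : Om := fun n => pick (st n).
(* [glue n v] is v with the first n chosen entries put in front: membership in
   the n-th section means membership of the glued sequence. *)
pose glue n (v : Om) : Om := fun i => if (i < n)%N then w i else v (i - n)%N.
have glue0 v : glue 0%N v = v by apply/funext => i; rewrite /glue ltn0 subn0.
have glueS n v : glue n (path_cons (w n, v)) = glue n.+1 v.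
  apply/funext => i; rewrite /glue ltnS.
  have [lt_in|lt_ni|->] := ltngtP i n; last by rewrite subnn.
  - by [].
  - by rewrite /path_cons -(subnSK lt_ni).
have st1 n v : (st n).1 v = A (glue n v).
  by elim: n v => [|n IH] v /=; rewrite ?glue0// -glueS -IH.
have st2 n k v : (st n).2 k v = F k (glue n v).
  by elim: n v => [|n IH] v /=; rewrite ?glue0// -glueS -IH.
have gluew n v i : (i < n)%N -> glue n v i = w i by rewrite /glue => ->.
have Aw : A w.
  have [cS _ ltS] := stP (rank A).
  have /set0P[v] : (st (rank A)).1 != set0.
    apply/eqP => S0; move: ltS; rewrite S0 /cylinder_content measure0.
    by apply/negP; rewrite -leNgt; apply: nneseries_ge0 => k _ _;
      exact: cylinder_content_ge0.
  rewrite st1; apply: (rankP cA); exact: gluew.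
have [k _ Fkw] := AF _ Aw.
have [cS cT ltS] := stP (rank (F k)).
have FT : (st (rank (F k))).2 k = setT.
  apply/seteqP; split => // v _; rewrite st2.
  apply: (rankP (cF k)) Fkw => i ik; exact/esym/gluew.
have := lt_le_trans ltS (cylinder_content_le1 cS).
apply/negP; rewrite -leNgt -cylinder_contentT -FT.
rewrite (nneseries_split _ k.+1)// add0n.
rewrite big_nat_recr//= -addeA -[leLHS]add0e leeD//.
  by apply: sume_ge0 => i _; exact: cylinder_content_ge0.
rewrite leeDl//; apply: nneseries_ge0 => i _ _; exact: cylinder_content_ge0.
Qed.

HB.instance Definition _ := Content_SigmaSubAdditive_isMeasure.Build _ _ _
  cylinder_content cylinder_content_sigma_subadditive.

Let I := g_sigma_algebraType (@measurable _ cyl).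

Let cylinder_measure : set I -> \bar R := measure_extension cylinder_content.

HB.instance Definition _ := Measure.on cylinder_measure.

Let cylinder_measureT : cylinder_measure setT = 1.
Proof.
rewrite -cylinder_contentT; apply: measurable_mu_extE.
exact: (@measurableT _ cyl).
Qed.

HB.instance Definition _ :=
  Measure_isProbability.Build _ _ _ cylinder_measure cylinder_measureT.

Let to_paths (w : I) : Om := w.

Let measurable_fun_to_paths : measurable_fun setT to_paths.
Proof. by move=> _ A; rewrite measurable_pathsE setTI. Qed.

Let to_paths_mfun : {mfun I >-> Om} :=
  HB.pack to_paths (isMeasurableFun.Build _ _ _ _ _ measurable_fun_to_paths).

(** The fixed-point equation says that the first entry has law mu and is
    independent of the shifted sequence, which has the same law again. This is
    the form in which independence is used. *)
Lemma iid_law_exists : exists Q : probability Om R, forall C, measurable C ->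
  Q C = step_law mu (@measurable_path_cons _ E) Q C.
Proof.
pose Q : probability Om R := distribution cylinder_measure to_paths_mfun.
have QE C : cylinder C -> Q C = cylinder_content C.
  by move=> cC; exact: measurable_mu_extE.
exists Q; apply: (@measure_unique _ R Om (@cylinder _ E) (fun=> setT) _ _ _ _
  Q (step_law mu (@measurable_path_cons _ E) Q)) => //.
- exact: measurable_pathsE.
- move=> C D cC cD; rewrite -[C `&` D]setCK setCI.
  by apply: cylinderC; apply: cylinderU; exact: cylinderC.
- by move=> _; split => //; exists 0%N.
- by rewrite bigcup_const.
- move=> C cC; apply: (etrans (QE C cC)); rewrite cylinder_content_section//.
  apply: eq_integral => g _.
  apply: (etrans (esym (QE _ (cylinder_cons_section g cC)))).
  by congr (Q _); apply/seteqP; split => w /=; rewrite xsectionE.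
- by move=> _; rewrite ltey_eq fin_num_measure.
Qed.

End iid_sequence.

(** * Existence of the chain *)

Section chain_existence.
Local Open Scope ereal_scope.
Context dE dY (E : measurableType dE) (Y : measurableType dY) (R : realType).
Variables (mu : probability E R) (f : E * Y -> Y).
Hypothesis mf : measurable_fun setT f.
Variable P : Y -> set Y -> \bar R.
Hypothesis PE : forall y A, measurable A ->
  P y A = transfer mu f (fun z => (\1_A z)%:E) y.

(** The recursion consumes the noise from the front and moves the starting
    point, to match the fixed-point equation of the law of the noise. *)
Fixpoint walk n (p : Y * paths E) : Y :=
  if n is k.+1 then walk k (f (p.2 0%N, p.1), fun i => p.2 i.+1) else p.1.

Lemma measurable_walk n : measurable_fun setT (walk n).
Proof.
elim: n => [|n IH] /=; first exact: measurable_fst.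
apply: (measurableT_comp IH); apply: measurable_fun_pair.
  apply: (measurableT_comp mf); apply: measurable_fun_pair => //.
  exact: (measurableT_comp (@measurable_coord _ _ 0%N) measurable_snd).
apply: measurable_to_paths => k.
exact: (measurableT_comp (@measurable_coord _ _ k.+1) measurable_snd).
Qed.

Let measurable_walk_from x n : measurable_fun setT (fun w => walk n (x, w)).
Proof.
by apply: measurableT_comp (measurable_walk n) _; exact: measurable_fun_pair.
Qed.

Definition walk_in n (A : nat -> set Y) (x : Y) : set (paths E) :=
  [set w | forall i, (i <= n)%N -> A i (walk i (x, w))].

Lemma measurable_walk_in n A x :
  (forall i, measurable (A i)) -> measurable (walk_in n A x).
Proof.
move=> mA; have -> : walk_in n A x =
    \bigcap_(i in [set i | (i <= n)%N]) ((fun w => walk i (x, w)) @^-1` A i).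
  by apply/seteqP; split.
by apply: bigcap_measurable => [|i _]; [exists 0%N|exact: measurable_preimage].
Qed.

Lemma walk_in_path_cons n A x g w : walk_in n.+1 A x (path_cons (g, w)) <->
  A 0%N x /\ walk_in n (fun i => A i.+1) (f (g, x)) w.
Proof.
split=> [h|[A0 h] [|i]//]; last exact: h.
split; first exact: (h 0%N).
by move=> i lein; exact: (h i.+1).
Qed.

Variable Q : probability (paths E) R.
Hypothesis QE : forall C, measurable C ->
  Q C = step_law mu (@measurable_path_cons _ E) Q C.

Lemma iid_lawE C : measurable C -> Q C = \int[mu]_g Q (cons_section C g).
Proof.
move=> mC; rewrite QE//; apply: eq_integral => g _ /=; congr (Q _).
by apply/seteqP; split => w /=; rewrite xsectionE.
Qed.

Lemma integral_iid_law h : (forall w, 0 <= h w) -> measurable_fun setT h ->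
  \int[Q]_w h w = \int[mu]_g \int[Q]_w h (path_cons (g, w)).
Proof.
move=> h0 mh.
rewrite (eq_measure_integral (step_law mu (@measurable_path_cons _ E) Q));
  last by move=> C mC _; exact: QE.
rewrite ge0_integral_distribution//.
apply: (@fubini_tonelli1 _ _ _ _ _ mu Q (h \o @path_cons _ E)).
- by apply: measurableT_comp => //; exact: measurable_path_cons.
- by move=> p; exact: h0.
Qed.

(** By induction on the time: drawing the first entry turns a walk of length
    n+1 from x into a walk of length n from a random image of x. *)
Lemma walk_markov n A x : (forall i, measurable (A i)) ->
  Q (walk_in n.+1 A x) = \int[Q]_(w in walk_in n A x)
    transfer mu f (fun z => (\1_(A n.+1) z)%:E) (walk n (x, w)).
Proof.
elim: n A x => [|n IH] A x mA.
  rewrite iid_lawE; last exact: measurable_walk_in.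
  have [Ax|nAx] := pselect (A 0%N x); last first.
    rewrite integral0_eq; last first.
      move=> g _; rewrite [X in Q X](_ : _ = set0) ?measure0//.
      by apply/seteqP; split => // w /walk_in_path_cons[].
    rewrite [walk_in _ _ _](_ : _ = set0) ?integral_set0//.
    by apply/seteqP; split => // w /(_ 0%N isT).
  rewrite [walk_in 0 _ _](_ : _ = setT); last first.
    by apply/seteqP; split => // w _ [].
  rewrite /= integral_cst//= probability_setT mule1.
  apply: eq_integral => g _; rewrite indicE.
  have [Ag|nAg] := pselect (A 1%N (f (g, x))).
    rewrite mem_set//= -(probability_setT Q); congr (Q _).
    by apply/seteqP; split => // w _; apply/walk_in_path_cons; split => // -[].
  rewrite memNset//= [X in Q X](_ : _ = set0) ?measure0//.
  by apply/seteqP; split => // w /walk_in_path_cons[_ /(_ 0%N isT)].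
rewrite iid_lawE; last exact: measurable_walk_in.
have mAS i : measurable (A i.+1) by [].
have F0 y : 0 <= transfer mu f (fun z => (\1_(A n.+2) z)%:E) y.
  by apply: transfer_ge0 => z; rewrite lee_fin.
have mF : measurable_fun setT (transfer mu f (fun z => (\1_(A n.+2) z)%:E)).
  by apply: measurable_transfer => //; exact: measurable_EFin_indic.
rewrite [RHS]integral_mkcond integral_iid_law; last 2 first.
- by move=> w; rewrite patchE; case: ifP.
- apply/(measurable_restrictT _ _).1 => //; first exact: measurable_walk_in.
  apply: measurable_funTS; exact: (measurableT_comp mF).
apply: eq_integral => g _.
have [Ax|nAx] := pselect (A 0%N x); last first.
  rewrite integral0_eq; last first.
    move=> w _; rewrite patchE memNset// => /walk_in_path_cons[]//.
  rewrite [X in Q X](_ : _ = set0) ?measure0//.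
  by apply/seteqP; split => // w /walk_in_path_cons[].
have -> : cons_section (walk_in n.+2 A x) g =
    walk_in n.+1 (fun i => A i.+1) (f (g, x)).
  apply/seteqP; split => w h; first by have /walk_in_path_cons[] := h.
  exact/walk_in_path_cons.
rewrite IH// integral_mkcond; apply: eq_integral => w _; rewrite !patchE.
have -> : (path_cons (g, w) \in walk_in n.+1 A x) =
    (w \in walk_in n (fun i => A i.+1) (f (g, x))).
  apply/idP/idP; rewrite !inE; first by move=> /walk_in_path_cons[].
  by move=> h; apply/walk_in_path_cons.
by [].
Qed.

Lemma chain_law_of_walk x : exists Q', is_chain_law P x Q'.
Proof.
pose W (w : paths E) : paths Y := fun n => walk n (x, w).
have mW : measurable_fun setT W.
  by apply: measurable_to_paths => n; exact: measurable_walk_from.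
pose W' : {mfun (paths E) >-> (paths Y)} :=
  HB.pack W (isMeasurableFun.Build _ _ _ _ _ mW).
exists (distribution Q W'); split.
  move=> A mA; rewrite /distribution /pushforward /= diracE.
  have [Ax|nAx] := pselect (A x).
    rewrite mem_set// -(probability_setT Q); congr (Q _).
    by apply/seteqP; split.
  rewrite memNset//; apply: etrans (measure0 Q); congr (Q _).
  by apply/seteqP; split.
move=> n A mA; apply: etrans (walk_markov n x mA) _.
have F0 y : 0 <= transfer mu f (fun z => (\1_(A n.+1) z)%:E) y.
  by apply: transfer_ge0 => z; rewrite lee_fin.
have mF : measurable_fun setT (transfer mu f (fun z => (\1_(A n.+1) z)%:E)).
  by apply: measurable_transfer => //; exact: measurable_EFin_indic.
under [RHS]eq_integral do rewrite PE//.
rewrite ge0_integral_pushforward//.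
- have -> : [set w : nat -> Y | forall i, (i <= n)%N -> A i (w i)] =
    \bigcap_(i in [set i | (i <= n)%N]) ((fun w => w i) @^-1` A i).
    by apply/seteqP; split.
  apply: bigcap_measurable => [|i _]; first by exists 0%N.
  exact: (measurable_preimage (@measurable_coord _ Y i)).
- by apply: measurable_funTS; exact: (measurableT_comp mF (measurable_coord n)).
Qed.

End chain_existence.

Lemma chain_law_exists dE dY (E : measurableType dE) (Y : measurableType dY)
    (R : realType) (mu : probability E R) (f : E * Y -> Y)
    (P : Y -> set Y -> \bar R) :
    measurable_fun setT f ->
    (forall y A, measurable A ->
      P y A = transfer mu f (fun z => (\1_A z)%:E) y) ->
  forall x, exists Q, is_chain_law P x Q.
Proof.
move=> mf PE x; have [Q QE] := iid_law_exists mu.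
exact: (chain_law_of_walk mf PE QE).
Qed.

(** * Stationary measures and avoided sets *)

Lemma ge0_integral_eq0P d (T : measurableType d) (R : realType)
    (m : {measure set T -> \bar R}) (F : T -> \bar R) :
    measurable_fun setT F -> (forall x, 0 <= F x)%E ->
  (\int[m]_x F x = 0)%E <-> m [set x | F x != 0%E] = 0%E.
Proof.
move=> mF F0.
have absF : (\int[m]_x `|F x| = \int[m]_x F x)%E.
  by apply: eq_integral => x _; rewrite gee0_abs.
have mS : measurable [set x | F x != 0%E].
  rewrite (_ : [set _ | _] = F @^-1` ~` [set 0%E]).
    exact: measurable_preimage mF (measurableC _).
  by apply/seteqP; split => x /= /eqP.
rewrite -absF; split=> [/(ae_eq_integral_abs m measurableT mF) F0'|m0].
  have : m.-negligible [set x | F x != 0%E].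
    by apply: negligibleS F0' => x /= Fx h; move: Fx; rewrite h// eqxx.
  by move/negligibleP => -> //.
apply/(ae_eq_integral_abs m measurableT mF).
apply: (@negligibleS _ _ _ _ [set x | F x != 0%E]); last exact/negligibleP.
by move=> x /= /not_implyP[_ /eqP].
Qed.

Section sections.
Local Open Scope ereal_scope.
Context d1 d2 (T1 : measurableType d1) (T2 : measurableType d2) (R : realType).
Variables (m1 : {sigma_finite_measure set T1 -> \bar R}).
Variables (m2 : {sigma_finite_measure set T2 -> \bar R}).

Lemma xsectionE_set (D : set (T1 * T2)) x : xsection D x = [set y | D (x, y)].
Proof. by apply/seteqP; split => y /=; rewrite xsectionE. Qed.

Lemma ysectionE_set (D : set (T1 * T2)) y : ysection D y = [set x | D (x, y)].
Proof. by apply/seteqP; split => x /=; rewrite ysectionE. Qed.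

Lemma measurable_measure_xsection (D : set (T1 * T2)) : measurable D ->
  measurable_fun setT (fun x => m2 [set y | D (x, y)]).
Proof.
move=> mD; have := measurable_fun_xsection m2 mD.
by apply: eq_measurable_fun => x _ /=; rewrite xsectionE_set.
Qed.

Lemma measurable_measure_ysection (D : set (T1 * T2)) : measurable D ->
  measurable_fun setT (fun y => m1 [set x | D (x, y)]).
Proof.
move=> mD; have := measurable_fun_ysection m1 mD.
by apply: eq_measurable_fun => x _ /=; rewrite ysectionE_set.
Qed.

(** Tonelli for an indicator function, in the set-comprehension form in which
    the exchange of integrals is used below. *)
Lemma tonelli_sections (D : set (T1 * T2)) : measurable D ->
  \int[m1]_x m2 [set y | D (x, y)] = \int[m2]_y m1 [set x | D (x, y)].
Proof.
move=> mD; have := indic_fubini_tonelli m1 m2 mD.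
rewrite indic_fubini_tonelli_FE// indic_fubini_tonelli_GE// => h.
rewrite (eq_integral (m2 \o xsection D)); last first.
  by move=> x _ /=; rewrite xsectionE_set.
by rewrite h; apply: eq_integral => y _ /=; rewrite ysectionE_set.
Qed.

End sections.

Section invariant_measure.
Local Open Scope ereal_scope.
Context dE dY (E : measurableType dE) (Y : measurableType dY) (R : realType).
Variables (mu : probability E R) (f : E * Y -> Y).
Hypothesis mf : measurable_fun setT f.
Variable m : {sigma_finite_measure set Y -> \bar R}.
Hypothesis m_inv : forall g A, measurable A ->
  m ((fun y => f (g, y)) @^-1` A) = m A.
Notation T := (transfer mu f).

Let mf1 g : measurable_fun setT (fun y => f (g, y)).
Proof. by apply: measurableT_comp => //; exact: measurable_fun_pair. Qed.

Lemma integral_translate g F :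
    (forall y, 0 <= F y) -> measurable_fun setT F ->
  \int[m]_y F (f (g, y)) = \int[m]_y F y.
Proof.
move=> F0 mF.
have F0' : {in [set: Y], forall y, 0 <= F y} by move=> y _; exact: F0.
apply: etrans (esym (ge0_integral_pushforward (mf1 g) m measurableT mF F0')) _.
by apply: eq_measure_integral => A mA _; exact: m_inv.
Qed.

(** An invariant measure is stationary. *)
Lemma integral_transfer F :
    (forall y, 0 <= F y) -> measurable_fun setT F ->
  \int[m]_y T F y = \int[m]_y F y.
Proof.
move=> F0 mF.
have := @fubini_tonelli _ _ _ _ R mu m (F \o f)
  (measurableT_comp mF mf) (fun p => F0 (f p)).
rewrite /fubini_G /fubini_F => <- /=.
under eq_integral do rewrite integral_translate//.
by rewrite integral_cst//= probability_setT mule1.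
Qed.

Lemma integral_iter_transfer n F :
    (forall y, 0 <= F y) -> measurable_fun setT F ->
  \int[m]_y iter n T F y = \int[m]_y F y.
Proof.
move=> F0 mF; elim: n => //= n IH; rewrite integral_transfer//.
- exact: iter_transfer_ge0.
- exact: measurable_iter_transfer.
Qed.

Variable A : set Y.
Hypothesis mA : measurable A.
Notation oneA := (fun y => (\1_A y)%:E : \bar R).

Let oneA_ge0 y : 0 <= oneA y.
Proof. by rewrite lee_fin. Qed.

Let m_oneA : measurable_fun setT oneA := measurable_EFin_indic mA.

(** By [hitting_prob_eq0], the points from which the chain almost surely does
    not visit A at a positive time. *)
Definition avoids : set Y := [set y | forall n, iter n.+1 T oneA y = 0].

Let mT n : measurable_fun setT (iter n T oneA).
Proof. exact: measurable_iter_transfer. Qed.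

Let T_ge0 n y : 0 <= iter n T oneA y.
Proof. exact: iter_transfer_ge0. Qed.

Let mTn n : measurable [set y | iter n T oneA y != 0].
Proof.
rewrite (_ : [set _ | _] = iter n T oneA @^-1` ~` [set 0]).
  exact: measurable_preimage (mT n) (measurableC _).
by apply/seteqP; split => y /= /eqP.
Qed.

Lemma setC_avoids : ~` avoids = \bigcup_n [set y | iter n.+1 T oneA y != 0].
Proof.
apply/seteqP; split => [y /existsNP[n /eqP] ?|y [n _ /= /eqP h] /(_ n)//].
by exists n.
Qed.

Lemma measurable_avoids : measurable avoids.
Proof.
rewrite -[avoids]setCK setC_avoids; apply: measurableC.
by apply: bigcup_measurable => n _; exact: mTn.
Qed.

Lemma avoids_conull : m A = 0 -> m (~` avoids) = 0.
Proof.
move=> A0; rewrite setC_avoids; apply/eqP; rewrite -measure_le0.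
apply: (le_trans (measure_sigma_subadditive _ _ _ (@subset_refl _ _))) => //.
  by apply: bigcup_measurable => n _; exact: mTn.
rewrite eseries0// => n _ _ /=; apply/ge0_integral_eq0P.
- exact: mT n.+1.
- exact: T_ge0 n.+1.
- by rewrite (integral_iter_transfer n.+1)// integral_indic// setIT.
Qed.

(** By stationarity the mass of A is the mean probability of being in A at time
    1, which vanishes on the avoided set. *)
Lemma null_of_avoids_conull : m (~` avoids) = 0 -> m A = 0.
Proof.
move=> Ac0; transitivity (\int[m]_y oneA y).
  by rewrite integral_indic// setIT.
rewrite -(integral_iter_transfer 1%N)//.
apply/ge0_integral_eq0P.
- exact: mT 1%N.
- exact: T_ge0 1%N.
- apply/eqP; rewrite -measure_le0 -[leRHS]Ac0 le_measure ?inE//.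
  + by apply: measurableC; exact: measurable_avoids.
  + by move=> y /= /eqP Ty /(_ 0%N).
Qed.

(** If the chain can move from y to a point that may later visit A, then it may
    visit A from y. *)
Lemma avoids_absorbing y : avoids y -> mu [set g | ~ avoids (f (g, y))] = 0.
Proof.
move=> By; rewrite (_ : [set g | _] = (fun g => f (g, y)) @^-1` ~` avoids) //.
have mfy : measurable_fun setT (fun g => f (g, y)).
  by apply: measurableT_comp => //; exact: measurable_fun_pair.
rewrite setC_avoids preimage_bigcup; apply/eqP; rewrite -measure_le0.
apply: (le_trans (measure_sigma_subadditive _ _ _ (@subset_refl _ _))) => //.
- by move=> n; exact: measurable_preimage.
- by apply: bigcup_measurable => n _; exact: measurable_preimage.
rewrite eseries0// => n _ _ /=.
apply/(ge0_integral_eq0P mu (F := fun g => iter n.+1 T oneA (f (g, y)))).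
- exact: measurableT_comp (mT n.+1) mfy.
- by move=> g; exact: T_ge0 n.+1 _.
- exact: By n.+1.
Qed.

Lemma iter_transfer_avoids y n : avoids y ->
  iter n T (fun z => (\1_(~` avoids) z)%:E) y = 0.
Proof.
have mB := measurable_avoids.
elim: n y => [|n IH] y By /=; first by rewrite indicE memNset.
rewrite /transfer; apply/ge0_integral_eq0P.
- apply: measurableT_comp; first apply: measurable_iter_transfer => //.
  + by apply: measurable_EFin_indic; exact: measurableC.
  + by apply: measurableT_comp => //; exact: measurable_fun_pair.
- by move=> g; apply: iter_transfer_ge0 => z; rewrite lee_fin.
- apply/eqP; rewrite -measure_le0 -[leRHS](avoids_absorbing By) le_measure ?inE//.
  + rewrite (_ : [set g | _] = (fun g => iter n T
      (fun z => (\1_(~` avoids) z)%:E) (f (g, y))) @^-1` ~` [set 0]).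
      apply: measurable_preimage (measurableC _) => //.
      apply: measurableT_comp; first apply: measurable_iter_transfer => //.
      * by apply: measurable_EFin_indic; exact: measurableC.
      * by apply: measurableT_comp => //; exact: measurable_fun_pair.
    by apply/seteqP; split => g /= /eqP.
  + apply: (@measurable_preimage _ _ _ _ (fun g => f (g, y)) (~` avoids)).
      by apply: measurableT_comp => //; exact: measurable_fun_pair.
    exact: measurableC.
  + by move=> g /= /eqP Tg /IH.
Qed.

(** Integrate [avoids_absorbing] over the avoided set and exchange the
    integrals. *)
Lemma avoids_almost_invariant :
  mu [set g | m [set y | avoids y /\ ~ avoids (f (g, y))] != 0] = 0.
Proof.
have mB := measurable_avoids.
pose D := [set p : E * Y | avoids p.2 /\ ~ avoids (f p)].
have mD : measurable D.
  apply: measurableI; first exact: measurable_preimage measurable_snd mB.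
  exact: measurable_preimage mf (measurableC mB).
apply/(ge0_integral_eq0P mu).
- exact: measurable_measure_xsection mD.
- by move=> g; exact: measure_ge0.
- rewrite (tonelli_sections mu m mD) integral0_eq// => y _.
  have [By|nBy] := pselect (avoids y).
    rewrite -[RHS](avoids_absorbing By); congr (mu _).
    by apply/seteqP; split => g //= [].
  apply: etrans (measure0 mu); congr (mu _).
  by apply/seteqP; split => g //= [].
Qed.

End invariant_measure.

(** * Invariant measures of transitive actions *)

Section transitive_action.
Local Open Scope ereal_scope.
Context (R : realType) (G : topGroupType) dY (Y : measurableType dY).
Variable a : G -> Y -> Y.
Hypothesis aM : forall g h y, a (g * h)%g y = a g (a h y).
Hypothesis a_trans : forall x y, exists g, a g x = y.
Hypothesis ma : measurable_fun setT (fun p : borel G * Y => a (p.1^-1)%g p.2).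
Variable m : {sigma_finite_measure set (borel G) -> \bar R}.
Hypothesis m_inv : forall (g : G) (A : set (borel G)), measurable A ->
  m ((fun x : G => (g * x)%g) @^-1` A) = m A.
Variable lam : {sigma_finite_measure set Y -> \bar R}.
Hypothesis lam_inv : forall g C, measurable C -> lam (a g @^-1` C) = lam C.

Lemma measurable_orbit_preimage C x : measurable C ->
  measurable ([set g | C (a (g^-1)%g x)] : set (borel G)).
Proof.
move=> mC.
apply: (@measurable_preimage _ _ _ _ (fun g : borel G => a (g^-1)%g x) C) => //.
exact: (measurableT_comp ma (measurable_fun_pair (@measurable_id _ _ setT)
  (@measurable_cst _ _ _ _ setT x))).
Qed.

(** Moving the base point translates the set on the left, which m does not see.
    This is why the inverse appears: without it the translation would be on the
    right. *)
Lemma orbit_measure_const C x y : measurable C ->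
  m [set g | C (a (g^-1)%g x)] = m [set g | C (a (g^-1)%g y)].
Proof.
move=> mC; have [h <-] := a_trans y x.
rewrite -[RHS](m_inv (h^-1)%g); last exact: measurable_orbit_preimage.
by congr (m _); apply/seteqP; split => g /=; rewrite invgM invgK aM.
Qed.

(** Integrate 1_C (a g^-1 y) over g and y in both orders. *)
Lemma orbit_measure C x : measurable C ->
  m [set g | C (a (g^-1)%g x)] * lam setT = lam C * m setT.
Proof.
move=> mC; pose D := [set p : borel G * Y | C (a (p.1^-1)%g p.2)].
have mD : measurable D by exact: measurable_preimage ma mC.
have := tonelli_sections m lam mD.
rewrite (eq_integral (cst (lam C))); last first.
  by move=> g _; exact: (lam_inv (g^-1)%g mC).
rewrite [RHS](eq_integral (cst (m [set g | C (a (g^-1)%g x)]))); last first.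
  by move=> y _; exact: orbit_measure_const.
by rewrite !integral_cst.
Qed.

Hypotheses (m_neq0 : m setT != 0) (lam_neq0 : lam setT != 0).

Lemma orbit_measure_eq0 C x : measurable C ->
  m [set g | C (a (g^-1)%g x)] = 0 <-> lam C = 0.
Proof.
move=> /(orbit_measure x) h; split=> h0; move: h; rewrite h0 mul0e.
  by move/esym/eqP; rewrite mule_eq0 (negbTE m_neq0) orbF => /eqP.
by move/eqP; rewrite mule_eq0 (negbTE lam_neq0) orbF => /eqP.
Qed.

(** Almost every y in B has almost all of its orbit in B. One such y exists
    unless B is null, and by transitivity its orbit sees the whole measure
    class of lam. *)
Lemma transitive_ergodic B : measurable B ->
    (forall g, lam [set y | B y /\ ~ B (a g y)] = 0) ->
  lam B = 0 \/ lam (~` B) = 0.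
Proof.
move=> mB B_inv.
pose D := [set p : borel G * Y | B p.2 /\ ~ B (a (p.1^-1)%g p.2)].
have mD : measurable D.
  apply: measurableI; first exact: measurable_preimage measurable_snd mB.
  exact: measurable_preimage ma (measurableC mB).
have := tonelli_sections m lam mD; rewrite integral0_eq; last first.
  by move=> g _; exact: (B_inv (g^-1)%g).
move/esym/(ge0_integral_eq0P _ (measurable_measure_ysection m mD) _).1.
move=> /(_ (fun y => measure_ge0 _ _)) D0.
have [B0|B_neq0] := eqVneq (lam B) 0; [by left|right].
have [y [By Dy]] : exists y, B y /\ m [set g | D (g, y)] = 0.
  apply: contrapT => noy; move/eqP : B_neq0; apply.
  apply/eqP; rewrite -measure_le0 -[leRHS]D0 le_measure ?inE//.
    rewrite (_ : [set x | _] = (fun y => m [set g | D (g, y)]) @^-1` ~` [set 0]).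
      apply: measurable_preimage (measurableC _) => //.
      exact: measurable_measure_ysection mD.
    by apply/seteqP; split => y /= /eqP.
  by move=> y By /=; apply/eqP => Dy; apply: noy; exists y.
apply/(orbit_measure_eq0 y (measurableC mB)).
by rewrite -Dy; congr (m _); apply/seteqP; split => g //= [].
Qed.

End transitive_action.

(** * Countable bases and Borel measurability *)

Section countable_bases.

(** A base given as an indexed family, so that indices can be paired and pushed
    forward along open maps. *)
Definition open_base (T : topologicalType) (I : Type) (B : I -> set T) : Prop :=
  (forall i, open (B i)) /\
  forall x U, open U -> U x -> exists i, B i x /\ B i `<=` U.

(** An open subset of the product is a countable union of rectangles of basic
    open sets, so it belongs to the product of the Borel sigma-algebras. *)
Lemma measurable_continuous2 (T1 T2 T3 : ptopologicalType) (I1 I2 : countType)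
    (B1 : I1 -> set T1) (B2 : I2 -> set T2) (f : T1 * T2 -> T3) :
    open_base B1 -> open_base B2 -> continuous f ->
  measurable_fun setT (f : borel T1 * borel T2 -> borel T3).
Proof.
move=> [oB1 nB1] [oB2 nB2] cf.
apply: (@measurability _ _ _ (borel T3) setT _ (@open T3)) => //.
move=> _ [U oU <-]; rewrite setTI.
have oW : open (f @^-1` U) by move/continuousP : cf; apply.
pose F (ij : I1 * I2) : set (borel T1 * borel T2) :=
  if `[< B1 ij.1 `*` B2 ij.2 `<=` f @^-1` U >] then B1 ij.1 `*` B2 ij.2 else set0.
have -> : f @^-1` U = \bigcup_ij F ij.
  apply/seteqP; split => [[x y] Uxy|[x y] [ij _]]; last first.
    by rewrite /F; case: ifPn => // /asboolP; apply.
  move: oW; rewrite openE => /(_ _ Uxy)[[V1 V2] /= [V1x V2y] VU].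
  have [i [ix iV]] := nB1 x _ (open_interior V1) V1x.
  have [j [jy jV]] := nB2 y _ (open_interior V2) V2y.
  exists (i, j) => //; rewrite /F ifT//; apply/asboolP => -[u v] [/= iu jv].
  by apply: VU; split; apply: interior_subset; [exact: iV|exact: jV].
apply: countable_bigcupT_measurable => [|ij]; first exact: countableP.
rewrite /F; case: ifP => // _; apply: measurableX; exact: sub_sigma_algebra.
Qed.

Lemma measurable_continuous (T1 T2 : ptopologicalType) (f : T1 -> T2) :
  continuous f -> measurable_fun setT (f : borel T1 -> borel T2).
Proof.
move=> /continuousP cf.
apply: (@measurability _ _ (borel T1) (borel T2) setT f (@open T2)) => //.
by move=> _ [U oU <-]; rewrite setTI; apply: sub_sigma_algebra; exact: cf.
Qed.

Lemma measurable_compact (T : ptopologicalType) (K : set T) :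
  hausdorff_space T -> compact K -> measurable (K : set (borel T)).
Proof.
move=> hT /(compact_closed hT) cK; rewrite -[K]setCK; apply: measurableC.
by apply: sub_sigma_algebra; exact: closed_openC.
Qed.

End countable_bases.

Section metrizable_spaces.
Context (R : realType) (T : ptopologicalType).
Hypothesis hT : metrizable R T.

Lemma metrizable_hausdorff : hausdorff_space T.
Proof.
have [d [d0 dC dT nb]] := hT => p q pq; apply/d0/eqP.
rewrite eq_le; apply/andP; split; last first.
  have := dT p q p; rewrite (d0 p p).2// [d q p]dC; lra.
rewrite leNgt; apply/negP => d_gt0.
have ballP x e : 0 < e -> nbhs x [set y | d x y < e].
  by move=> e0; rewrite nb; exists e.
have e0 : 0 < d p q / 2 by lra.
have [z [/= pz qz]] := pq _ _ (ballP p _ e0) (ballP q _ e0).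
have := dT p z q; rewrite [d z q]dC; lra.
Qed.

(** For each k, every compact piece is covered by finitely many balls of radius
    1/(k+1); these balls form a base. *)
Lemma metrizable_sigma_compact_base : sigma_compact T ->
  exists B : nat * nat * nat -> set T, open_base B.
Proof.
have [d [d0 dC dT nb]] := hT => -[K cK KT].
pose ball x e := [set y | d x y < e].
have oball x e : open (ball x e).
  rewrite openE => y xy; rewrite /interior nb; exists (e - d x y) => /=.
    by rewrite subr_gt0.
  by move=> z; rewrite /ball /=; have := dT x y z; lra.
have dxx x : d x x = 0 by exact/d0.
pose rad (k : nat) : R := k.+1%:R^-1.
have rad_gt0 k : 0 < rad k by rewrite invr_gt0 ltr0n.
have /choice[D DP] : forall nk : nat * nat, exists D : {fset T},
    K nk.1 `<=` cover [set` D] (fun x => ball x (rad nk.2)).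
  move=> [n k]; have := cK n; rewrite compact_cover => /(_ _ setT
    (fun x => ball x (rad k)))[].
  - by move=> x _; exact: oball.
  - by move=> x _; exists x => //; rewrite /ball /= dxx.
  - by move=> D _ DK; exists D.
exists (fun i => ball (nth point (D i.1) i.2) (rad i.1.2)); split.
  by move=> i; exact: oball.
move=> x U oU Ux; have : nbhs x U by exact: open_nbhs_nbhs.
rewrite nb => -[e /= e0 eU].
have [k ke] : exists k, rad k * 2 < e.
  have := archi_boundP (ltW (divr_gt0 (ltr0Sn _ 1) e0)).
  set k := Num.bound _ => ke; exists k.
  rewrite /rad mulrC ltr_pdivrMr ?ltr0n// -ltr_pdivrMl// mulrC.
  by apply: (lt_le_trans ke); rewrite ler_nat.
have [n _ Knx] : (\bigcup_n K n) x by rewrite KT.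
have [y Dy xy] := DP (n, k) _ Knx.
exists (n, k, index y (D (n, k))) => /=; rewrite nth_index//; split => //.
move=> z; rewrite /ball /= => yz; apply: eU => /=.
move: xy; rewrite /ball /= => xy.
have := dT x y z; rewrite [d x y]dC; lra.
Qed.

End metrizable_spaces.

(** * Topology of the coset space *)

Section coset_space_topology.
Local Open Scope quotient_scope.
Context (G : topGroupType) (Gamma : groupClosed G).
Notation X := (coset_space Gamma).
Notation pi := (@coset_pi G Gamma).
Notation act := (@coset_act G Gamma).

Lemma mulg_nbhs (g h : G) (U : set G) : nbhs (g * h)%g U ->
  exists V W, [/\ nbhs g V, nbhs h W & forall v w, V v -> W w -> U (v * w)%g].
Proof.
move=> /(@mulg_continuous G (g, h)) [[V W] /= [Vg Wh] VWU].
by exists V, W; split => // v w Vv Ww; exact: (VWU (v, w)).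
Qed.

Lemma mulgr_continuous (h : G) : continuous (fun g : G => (g * h)%g).
Proof.
move=> g U /mulg_nbhs[V [W [Vg Wh VWU]]].
by apply: filterS Vg => v Vv; apply: VWU => //; exact: nbhs_singleton.
Qed.

Lemma coset_pi_surj (x : X) : exists h, pi h = x.
Proof.
by exists (repr (x : {eq_quot (lcoset_equiv Gamma)})); rewrite /coset_pi reprK.
Qed.

Lemma coset_pi_eq (g h : G) : pi g = pi h <-> (g^-1 * h)%g \in Gamma.
Proof. by split=> [/eqmodP|gh]//; apply/eqmodP. Qed.

Lemma coset_pi_continuous : continuous pi.
Proof. exact: pi_continuous. Qed.

(** The saturation of U is the union of its right translates by Gamma. *)
Lemma coset_pi_open (U : set G) : open U -> open (pi @` U).
Proof.
move=> oU; rewrite /open /= /quotient_open.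
have -> : \pi_(X)%qT @^-1` (pi @` U) =
    \bigcup_(c in [set` Gamma]) ((fun g => (g * c)%g) @^-1` U).
  apply/seteqP; split => [g [u Uu ug]|g [c /= Gc Ugc]].
    exists (g^-1 * u)%g; last by rewrite /= mulVKg.
    by apply/coset_pi_eq; rewrite ug.
  by exists (g * c)%g => //; apply/esym/coset_pi_eq; rewrite mulKg.
apply: bigcup_open => c _; apply: open_comp => // g _; exact: mulgr_continuous.
Qed.

(** The projection is open, so continuity descends from the multiplication of G
    even though a product of quotient maps need not be a quotient map. *)
Lemma coset_act_continuous : continuous (fun p : G * X => act p.1 p.2).
Proof.
move=> [g x]; have [h <-] := coset_pi_surj x; move=> U /=.
rewrite coset_act_pi => /coset_pi_continuous /mulg_nbhs[V [W [Vg Wh VWU]]].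
exists (V, pi @` W°); first split => //=.
  apply: (@open_nbhs_nbhs X (pi h)); split; first exact/coset_pi_open/open_interior.
  by exists h.
move=> [v _] [/= Vv [w Ww <-]]; rewrite /= coset_act_pi.
by apply: VWU => //; exact: interior_subset.
Qed.

Lemma coset_act_continuousr g : continuous (act g).
Proof.
move=> x U /(@coset_act_continuous (g, x)) [[V W] /= [Vg Wx] VWU].
apply: filterS Wx => w Ww; apply: (VWU (g, w)); split => //.
exact: nbhs_singleton.
Qed.

Lemma coset_actM g h x : act (g * h)%g x = act g (act h x).
Proof. by have [k <-] := coset_pi_surj x; rewrite !coset_act_pi mulgA. Qed.

Lemma coset_act1 x : act 1%g x = x.
Proof. by have [k <-] := coset_pi_surj x; rewrite coset_act_pi mul1g. Qed.

Lemma coset_act_transitive x y : exists g, act g x = y.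
Proof.
have [h <-] := coset_pi_surj x; have [k <-] := coset_pi_surj y.
by exists (k * h^-1)%g; rewrite coset_act_pi mulgVK.
Qed.

Lemma coset_space_base (I : Type) (B : I -> set G) :
  open_base B -> open_base (fun i => pi @` B i).
Proof.
move=> [oB nB]; split=> [i|x U oU]; first exact: coset_pi_open.
have [h <-] := coset_pi_surj x => Uh.
have [|i [Bih BiU]] := nB h (pi @^-1` U) _ Uh.
  by move/continuousP : coset_pi_continuous; apply.
by exists i; split; [exists h|move=> _ [b Bib <-]; exact: BiU].
Qed.

Hypotheses (hG : hausdorff_space G) (hGamma : discrete_subgroup Gamma).

(** A neighbourhood of g small enough that its quotients u^-1 v fall in an open
    set isolating 1 contains at most one point of Gamma. *)
Lemma discrete_subgroup_closed : closed [set` Gamma].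
Proof.
have G1 : [set` Gamma] 1%g by exact: gpred1.
have [_ [U U1 UG]] := hGamma G1.
move=> g clg.
have : nbhs (g^-1 * g)%g U by rewrite mulVg.
move=> /mulg_nbhs[V [W [Vg Wg VWU]]].
have VV : nbhs g ([set u : G | V (u^-1)%g]) by exact: (@invg_continuous G g).
have Ng : nbhs g ([set u : G | V (u^-1)%g] `&` W) by exact: filterI.
have [c [Gc [Vc Wc]]] := clg _ Ng.
(* Every neighbourhood of g meets Gamma near g, hence in c itself. *)
suff -> : g = c by [].
apply: hG => A B Ag Bc.
have [c' [Gc' [[_ Wc'] Ac']]] := clg _ (filterI Ng Ag).
suff cc' : c' = c by exists c; split; [rewrite -cc'|exact: nbhs_singleton].
have : (U `&` [set` Gamma]) (c^-1 * c')%g.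
  by split; [exact: VWU|rewrite /= gpredM ?gpredV].
by rewrite UG /= => /(canRL (mulVKg c)); rewrite mulg1.
Qed.

(** Distinct cosets g and h are separated because g^-1 h has a neighbourhood
    outside the closed set Gamma. *)
Lemma coset_space_hausdorff : hausdorff_space X.
Proof.
rewrite open_hausdorff => x y.
have [g <-] := coset_pi_surj x; have [h <-] := coset_pi_surj y => gh.
have nGgh : ~ (g^-1 * h)%g \in Gamma.
  by move=> /coset_pi_eq/eqP; rewrite (negbTE gh).
have : nbhs (g^-1 * h)%g (~` [set` Gamma]).
  apply: open_nbhs_nbhs; split => //; exact/closed_openC/discrete_subgroup_closed.
move=> /mulg_nbhs[V [W [Vg Wh VWU]]].
have {}Vg : nbhs g ([set u : G | V (u^-1)%g]) by exact: (@invg_continuous G g).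
exists (pi @` ([set u : G | V (u^-1)%g])°, pi @` W°) => /=.
  by split; apply/mem_set; [exists g|exists h].
split; try by apply: coset_pi_open; exact: open_interior.
apply/eqP/seteqP; split => // _ [[u /interior_subset Vu <-]].
move=> [w /interior_subset Ww /esym/coset_pi_eq]; exact: VWU.
Qed.

End coset_space_topology.

(** * The almost-stabiliser of a set *)

Section radon_approximation.
Local Open Scope ereal_scope.

Lemma radon_approx (R : realType) (T : ptopologicalType)
    (m : {finite_measure set (borel T) -> \bar R}) (A : set (borel T)) (e : R) :
    hausdorff_space T -> radon m -> measurable A -> (0 < e)%R ->
  exists K : set T, [/\ compact K, K `<=` A & m (A `\` K) < e%:E].
Proof.
move=> hT [_ mR] mA e0.
have mA_fin : m A \is a fin_num by exact: fin_num_measure.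
have := mA_fin; rewrite (mR A mA) => sup_fin.
have [_ [K [cK KA] <-]] := ub_ereal_sup_adherent e0 sup_fin.
rewrite -(mR A mA) => ltK; exists K; split => //.
have mK : measurable (K : set (borel T)) by exact: measurable_compact.
rewrite measureD//; last by rewrite ltey_eq mA_fin.
rewrite setIidr// lteBlDr ?fin_num_measure//.
by rewrite lteBlDl in ltK.
Qed.

End radon_approximation.

Section almost_stabilizer.
Local Open Scope ereal_scope.
Context (R : realType) (G : topGroupType) (Gamma : groupClosed G).
Notation X := (coset_space Gamma).
Notation act := (@coset_act G Gamma).
Variable mX : {finite_measure set (borel X) -> \bar R}.
Hypothesis hmX : invariant_volume mX.
Hypothesis hX : hausdorff_space X.
Variable B : set (borel X).
Hypothesis mB : measurable B.

Definition almost_stabilizer : set G :=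
  [set g | mX [set y | B y /\ ~ B (act g y)] = 0].

Let m_act g : measurable_fun setT (act g : borel X -> borel X).
Proof. by apply: measurable_continuous; exact: coset_act_continuousr. Qed.

Let mX_inv g (A : set (borel X)) : measurable A -> mX (act g @^-1` A) = mX A.
Proof. by have [_ _] := hmX; apply. Qed.

Let m_pre g (A : set (borel X)) : measurable A ->
  measurable (act g @^-1` A : set (borel X)).
Proof. exact: measurable_preimage. Qed.

Let mX_fin (A : set (borel X)) : measurable A -> mX A < +oo.
Proof. by move=> mA; rewrite ltey_eq fin_num_measure. Qed.

Let actVK g y : act (g^-1)%g (act g y) = y.
Proof. by rewrite -coset_actM mulVg coset_act1. Qed.

Let actKV g y : act g (act (g^-1)%g y) = y.
Proof. by rewrite -coset_actM mulgV coset_act1. Qed.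

(** B and its translate have the same finite mass, so if one is almost
    contained in the other, they are almost equal. *)
Lemma almost_stabilizerV g : almost_stabilizer g -> almost_stabilizer (g^-1)%g.
Proof.
rewrite /almost_stabilizer /= => Hg.
have mC := m_pre g mB.
have BC : mX (B `\` act g @^-1` B) = 0 by [].
rewrite -(mX_inv g); last by apply: measurableD => //; exact: m_pre.
have -> : act g @^-1` [set y | B y /\ ~ B (act (g^-1)%g y)] =
    (act g @^-1` B) `\` B.
  by apply/seteqP; split => y /=; rewrite actVK.
move: BC; rewrite !measureD// ?mX_fin//.
by rewrite [X in _ -> X - _ = _](mX_inv g mB) [_ `&` B]setIC.
Qed.

Lemma almost_stabilizerM g h :
  almost_stabilizer g -> almost_stabilizer h -> almost_stabilizer (g * h)%g.
Proof.
rewrite /almost_stabilizer /= => Hg Hh.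
have mD k : measurable ([set y | B y /\ ~ B (act k y)] : set (borel X)).
  by apply: measurableD => //; exact: m_pre.
apply/eqP; rewrite -measure_le0.
have <- : mX ([set y | B y /\ ~ B (act h y)] `|`
    act h @^-1` [set y | B y /\ ~ B (act g y)]) = 0.
  apply/eqP; rewrite -measure_le0 (le_trans (measureU2 _ _ _))//.
    exact: m_pre.
  by rewrite /= mX_inv// Hg Hh adde0.
rewrite le_measure ?inE//; first by apply: measurableU => //; exact: m_pre.
move=> y [/= By]; rewrite coset_actM => nB.
by have [Bhy|nBhy] := pselect (B (act h y)); [right|left].
Qed.

(** Approximate B from inside by a compact K and g K from outside by an open V,
    each up to e/2. For h near g the translate h K is still inside V, and it
    fills V up to e/2 because it has the same mass as g K; if h is in the
    almost-stabiliser, then h K is almost inside B. So g B exceeds B by at most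
    e. *)
Lemma almost_stabilizer_closed : closed almost_stabilizer.
Proof.
move=> g clg; rewrite /almost_stabilizer /=.
have [mXR _ _] := hmX.
apply/eqP; rewrite -measure_le0; apply/lee_addgt0Pr => e e0; rewrite add0e.
have e20 : (0 < e / 2)%R by rewrite divr_gt0.
have [K [cK KB ltK]] := radon_approx hX mXR mB e20.
have mK : measurable (K : set (borel X)) by exact: measurable_compact.
pose tr h : set (borel X) := act (h^-1)%g @^-1` K.
have mtr h : measurable (tr h) by exact: m_pre.
have [K' [cK' K'g ltK']] := radon_approx hX mXR (measurableC (mtr g)) e20.
have mK' : measurable (K' : set (borel X)) by exact: measurable_compact.
pose V : set X := ~` K'.
have oV : open V by apply: closed_openC; exact: compact_closed.
have mV : measurable (V : set (borel X)) by exact: measurableC.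
(* Tube lemma, from the compactness of K. *)
have near_g : \forall h \near g, K `<=` (fun y => V (act h y)).
  apply: ((compact_near_coveringP K).1 cK G (nbhs g) (fun h y => V (act h y))).
  move=> y Ky.
  have Vgy : V (act g y) by move=> /K'g; apply; rewrite /tr /= actVK.
  have : nbhs (act g y) V by exact: open_nbhs_nbhs.
  move=> /(@coset_act_continuous _ _ (g, y)) [[U W] /= [Ug Wy] UWV].
  by exists (W, U) => // -[y' h] [/= Wy' Uh]; exact: (UWV (h, y')).
have [h [Hh hKV]] := clg _ near_g.
have VhE k : tr k `<=` V -> mX (V `\` tr k) = mX V - mX K.
  move=> /setIidr kV; rewrite measureD ?mX_fin// kV; congr (_ - _).
  exact: mX_inv.
have trgV : tr g `<=` V by move=> y gy /K'g; apply.
have trhV : tr h `<=` V by move=> y /hKV; rewrite actKV.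
have mD k (A : set (borel X)) : measurable A ->
    measurable ([set y | A y /\ ~ B (act k y)] : set (borel X)).
  by move=> mA; apply: measurableD => //; exact: m_pre.
have trhB : mX (tr h `\` B) = 0.
  apply/eqP; rewrite -measure_le0 -[leRHS]Hh.
  rewrite -[leLHS](mX_inv h (measurableD (mtr h) mB)).
  rewrite le_measure ?inE//.
  - by apply: m_pre; exact: measurableD.
  - exact: mD.
  - by move=> y [] /=; rewrite /tr /= actVK => /KB.
apply: (@le_trans _ _ (mX (B `\` K) + mX [set y | K y /\ ~ B (act g y)])).
  apply: le_trans (measureU2 _ _ _); [|exact: measurableD|exact: mD].
  rewrite le_measure ?inE//; [exact: mD| |].
    by apply: measurableU; [exact: measurableD|exact: mD].
  by move=> y [By nB]; have [Ky|nKy] := pselect (K y); [right|left].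
rewrite [e in leRHS]splitr EFinD leeD//; first exact: ltW.
apply: (@le_trans _ _ (mX (V `\` tr h) + mX (tr h `\` B))); last first.
  rewrite trhB adde0 (VhE _ trhV) -(VhE _ trgV); apply/ltW.
  by rewrite (_ : _ `\` _ = ~` tr g `\` K')//; rewrite !setDE setIC.
apply: le_trans (measureU2 _ _ _); [|exact: measurableD|exact: measurableD].
rewrite (_ : [set y | _] = act g @^-1` (tr g `\` B)); last first.
  by apply/seteqP; split => y /=; rewrite /tr /= actVK.
rewrite /= mX_inv; last exact: measurableD.
rewrite le_measure ?inE//; [exact: measurableD| |].
  by apply: measurableU; exact: measurableD.
move=> y [gy nBy]; have [hy|nhy] := pselect (tr h y); [by right|left].
by split => //; exact: trgV.
Qed.

Lemma almost_stabilizer_subgroup : closed_subgroup almost_stabilizer.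
Proof.
split; first exact: almost_stabilizer_closed.
split.
  apply/mem_set; rewrite /almost_stabilizer /= -[RHS](measure0 mX); congr (mX _).
  by apply/seteqP; split => y //= []; rewrite coset_act1.
move=> g h /set_mem Hg /set_mem Hh; apply/mem_set.
by apply: almost_stabilizerM => //; exact: almost_stabilizerV.
Qed.

End almost_stabilizer.

(** * The random walk on the coset space *)

(** The walk on an orbit is the image of the walk on the group. *)
Lemma iter_transfer_equivariant dE dY dZ (E : measurableType dE)
    (Y : measurableType dY) (Z : measurableType dZ) (R : realType)
    (mu : probability E R) (f : E * Y -> Y) (h : E * Z -> Z) (p : Y -> Z)
    (F : Z -> \bar R) n y :
    (forall g y, p (f (g, y)) = h (g, p y)) ->
  iter n (transfer mu f) (F \o p) y = iter n (transfer mu h) F (p y).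
Proof.
move=> pf; elim: n y => //= n IH y.
by apply: eq_integral => g _; rewrite IH pf.
Qed.

(** Haar measures come as plain measures; Tonelli wants a measure that is
    structurally sigma-finite. *)
Section sigma_finite_repackaging.
Context d (T : measurableType d) (R : realType).
Variable m : {measure set T -> \bar R}.
Hypothesis sm : sigma_finite setT m.

Let m' : set T -> \bar R := m.
HB.instance Definition _ := Measure.on m'.
HB.instance Definition _ := Measure_isSigmaFinite.Build _ _ _ m' sm.

Lemma sigma_finite_measure_of :
  exists m'' : {sigma_finite_measure set T -> \bar R}, forall A, m'' A = m A.
Proof. by exists m'. Qed.

End sigma_finite_repackaging.

Lemma radon_sigma_finite (R : realType) (T : ptopologicalType)
    (m : {measure set (borel T) -> \bar R}) :
  hausdorff_space T -> sigma_compact T -> radon m -> sigma_finite setT m.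
Proof.
move=> hT [K cK KT] [mK _]; exists K => [|n]; first by rewrite KT.
by split; [exact: measurable_compact|exact: mK].
Qed.

Lemma msupport_sub_closed (R : realType) (T : ptopologicalType)
    (m : set (borel T) -> \bar R) (H : set T) :
  closed H -> m (~` H) = 0%E -> msupport m `<=` H.
Proof.
move=> cH mH x mx; apply: contrapT => nHx.
have := mx (~` H) (conj (closed_openC cH) nHx).
by rewrite mH ltxx.
Qed.

Section random_walk.
Local Open Scope ereal_scope.
Context (R : realType) (G : topGroupType) (Gamma : groupClosed G).
Hypothesis hmetr : metrizable R G.
Hypothesis hsc : sigma_compact G.
Notation X := (coset_space Gamma).
Notation act := (@coset_act G Gamma).
Variable mu : probability (borel G) R.

Definition mul_fun (p : borel G * borel G) : borel G := (p.1 * p.2 : G)%g.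
Definition act_fun (p : borel G * borel X) : borel X := act p.1 p.2.

Lemma measurable_mul_fun : measurable_fun setT mul_fun.
Proof.
have [B hB] := metrizable_sigma_compact_base hmetr hsc.
exact: (measurable_continuous2 hB hB (@mulg_continuous G)).
Qed.

Lemma measurable_act_fun : measurable_fun setT act_fun.
Proof.
have [B hB] := metrizable_sigma_compact_base hmetr hsc.
apply: (measurable_continuous2 hB (coset_space_base Gamma hB)).
exact: coset_act_continuous.
Qed.

Lemma measurable_invg : measurable_fun setT (fun g : borel G => (g^-1)%g : borel G).
Proof. by apply: measurable_continuous; exact: invg_continuous. Qed.

Lemma walk_kernelE (x : borel X) (A : set (borel X)) :
  walk_kernel Gamma mu x A = transfer mu act_fun (fun z => (\1_A z)%:E) x.
Proof.
apply: eq_integral => g _; rewrite /= diracE indicE; congr ((nat_of_bool _)%:R%:E).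
by apply/idP/idP; rewrite !inE xsectionE.
Qed.

Lemma walk_chain_exists (x : borel X) :
  exists Q, is_chain_law (walk_kernel Gamma mu) x Q.
Proof.
apply: (chain_law_exists measurable_act_fun) => y A _.
exact: walk_kernelE.
Qed.

Lemma walk_hitting_eq0 (x : borel X) (A : set (borel X)) : measurable A ->
  hitting_prob (walk_kernel Gamma mu) x A = 0 <->
  forall n, iter n.+1 (transfer mu act_fun) (fun z => (\1_A z)%:E) x = 0.
Proof.
apply: (hitting_prob_eq0 measurable_act_fun) => [y C _|y].
  exact: walk_kernelE.
exact: walk_chain_exists.
Qed.

Lemma convolution_powE n : convolution_pow mu n =
  iter n (step_law mu measurable_mul_fun)
    (dirac (1%g : borel G) : probability (borel G) R) :> (set (borel G) -> \bar R).
Proof. by elim: n => //= n ->. Qed.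

Variable mX : {finite_measure set (borel X) -> \bar R}.
Hypothesis hmX : invariant_volume mX.

Let mX_inv g (A : set (borel X)) : measurable A ->
  mX ((fun y => act_fun (g, y)) @^-1` A) = mX A.
Proof. by have [_ _] := hmX; apply. Qed.

(** A null set is missed almost surely from almost every starting point,
    whereas irreducibility would let the walk hit it from all of them. *)
Lemma irreducible_dominated
    (phi : {sigma_finite_measure set (borel X) -> \bar R}) :
  irreducibility_measure (walk_kernel Gamma mu) phi -> phi `<< mX.
Proof.
move=> irr; apply/null_content_dominatesP => A mA A0.
apply/eqP; rewrite -measure_le0 leNgt; apply/negP => phiA.
have [_ mX0 _] := hmX.
have [y avoid_y] : exists y, avoids mu act_fun A y.
  apply: contrapT => noy; move/eqP : mX0; apply.
  rewrite -(avoids_conull mu measurable_act_fun mX_inv mA A0); congr (mX _).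
  by apply/seteqP; split => // y _ avoid_y; apply: noy; exists y.
have := irr A mA phiA y.
by rewrite ((walk_hitting_eq0 y mA).2 avoid_y) ltxx.
Qed.

Hypothesis hdisc : discrete_subgroup Gamma.
Hypothesis hspread : spread_out mu.
Hypothesis hadapted : adapted mu.

(** Almost invariance and ergodicity make B null; spread-outness then empties
    it, since from a point of B the convolution powers of mu live on a
    Haar-null set of group elements. *)
Lemma avoids_empty (A : set (borel X)) : measurable A -> 0 < mX A ->
  forall x, ~ avoids mu act_fun A x.
Proof.
move=> mA A_gt0.
have hG : hausdorff_space G by exact: metrizable_hausdorff hmetr.
have hX : hausdorff_space X by exact: coset_space_hausdorff.
have mB : measurable (avoids mu act_fun A).
  exact: (measurable_avoids mu measurable_act_fun mA).
set B := avoids mu act_fun A in mB *.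
have [_ mX0 _] := hmX.
have Bc_neq0 : mX (~` B) != 0.
  apply/eqP => Bc0; move: A_gt0.
  by rewrite (null_of_avoids_conull measurable_act_fun mX_inv mA Bc0) ltxx.
(* The almost-stabiliser of B is a closed subgroup of full mu-measure. *)
have B_inv g : mX [set y | B y /\ ~ B (act g y)] = 0.
  have cH := almost_stabilizer_subgroup hmX hX mB.
  have supH : msupport mu `<=` almost_stabilizer mX B.
    apply: msupport_sub_closed cH.1 _.
    rewrite -[RHS](avoids_almost_invariant mu measurable_act_fun mX mA).
    by congr (mu _); apply/seteqP; split => h /= /eqP.
  have gen_g : smallest (@closed_subgroup G) (msupport mu) g by rewrite hadapted.
  exact: (gen_g (almost_stabilizer mX B) (conj cH supH)).
have [m0 [m0R m0T m0_inv] [n n_gt0 nsing]] := hspread.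
have [m mE] := sigma_finite_measure_of (radon_sigma_finite hG hsc m0R).
have mT : m setT != 0 by rewrite mE.
have m_inv (g : G) (C : set (borel G)) : measurable C ->
    m ((fun x : G => (g * x)%g) @^-1` C) = m C.
  by move=> mC; rewrite !mE m0_inv.
have m_inv_first (Z : ptopologicalType) (h : borel G * borel Z -> borel Z) :
    measurable_fun setT h ->
    measurable_fun setT (fun p : borel G * borel Z => h ((p.1^-1)%g : G, p.2)).
  move=> mh; apply: (measurableT_comp mh); apply: measurable_fun_pair.
    exact: measurableT_comp measurable_invg measurable_fst.
  exact: measurable_snd.
have mactV := m_inv_first _ _ measurable_act_fun.
have mmulV := m_inv_first _ _ measurable_mul_fun.
have B0 : mX B = 0.
  have [//|Bc0] := transitive_ergodic (Y := borel X) (a := act) (@coset_actM G Gamma)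
    (@coset_act_transitive G Gamma) mactV m_inv mX_inv mT mX0 mB B_inv.
  by rewrite Bc0 eqxx in Bc_neq0.
move=> x Bx; apply: nsing.
(* [~` N] witnesses that the n-th convolution power is singular to m. *)
pose N : set (borel G) := [set g | B (act g x)].
have mN : measurable N.
  apply: (@measurable_preimage _ _ _ _ (fun g : borel G => act_fun (g, x)) B) => //.
  by apply: measurableT_comp measurable_act_fun _; exact: measurable_fun_pair.
exists (~` N); split; first exact: measurableC.
  rewrite convolution_powE iter_step_lawE; last exact: measurableC.
  pose offB (z : borel X) : \bar R := (\1_(~` B) z)%:E.
  rewrite (_ : (fun g => _) = offB \o (fun g : borel G => act g x)); last first.
    apply/funext => g; rewrite /offB /= !indicE; congr (_%:R%:E).
  rewrite (iter_transfer_equivariant _ (h := act_fun)).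
    rewrite coset_act1; exact: (iter_transfer_avoids measurable_act_fun mA n Bx).
  by move=> g h; exact: coset_actM.
rewrite setCK -mE.
have transl (g h : G) : exists k, (k * g)%g = h.
  by exists (h * g^-1)%g; rewrite mulgVK.
apply/(orbit_measure_eq0 (Y := borel G) (a := fun g h : G => (g * h)%g)
  (fun g h k => esym (mulgA g h k)) transl mmulV m_inv m_inv mT mT 1%g mN).
rewrite -[RHS]((orbit_measure_eq0 (Y := borel X) (a := act) (@coset_actM G Gamma)
  (@coset_act_transitive G Gamma) mactV m_inv mX_inv mT mX0 x mB).2 B0).
by congr (m _); apply/seteqP; split => g; rewrite /N /= mulg1.
Qed.

End random_walk.

Theorem corollary3p6 (R : realType) (G : topGroupType)
  (hmetr : metrizable R G)
  (hlc : locally_compact [set: G])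
  (hsc : sigma_compact G)
  (Gamma : groupClosed G)
  (hdisc : discrete_subgroup Gamma)
  (mu : probability (borel G) R)
  (hspread : spread_out mu)
  (hadapted : adapted mu)
  (mX : {finite_measure set (borel (coset_space Gamma)) -> \bar R})
  (hmX : invariant_volume mX) :
  psi_irreducible (walk_kernel Gamma mu) /\
  (exists psi : {sigma_finite_measure set (borel (coset_space Gamma)) -> \bar R},
     maximal_irreducibility_measure (walk_kernel Gamma mu) psi) /\
  (forall psi : {sigma_finite_measure set (borel (coset_space Gamma)) -> \bar R},
     maximal_irreducibility_measure (walk_kernel Gamma mu) psi ->
     psi `<< mX /\ mX `<< psi).
Proof.
have dominated := irreducible_dominated hmetr hsc hmX (mu := mu).
have irr : irreducibility_measure (walk_kernel Gamma mu) mX.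
  move=> A mA A_gt0 x; rewrite lt_neqAle measure_ge0 andbT eq_sym.
  apply/eqP => /(walk_hitting_eq0 hmetr hsc mu x mA).
  exact: (avoids_empty hmetr hsc hmX hdisc hspread hadapted mA A_gt0).
split; last split.
- by exists mX => //; have [_] := hmX.
- by exists mX; split.
- by move=> psi [irr_psi max_psi]; split; [exact: dominated|exact: max_psi].
Qed.
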